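(* Let $\mathcal{I}$ and $\mathcal{J}$ be ideals on $\omega$. Then (1) $\mathfrak{b}(\mathcal{I}\oplus\mathcal{J},\mathcal{I}\oplus\mathcal{J},\mathcal{I}\oplus\mathcal{J})=\min\{\mathfrak{b}(\mathcal{I},\mathcal{I},\mathcal{I}),\mathfrak{b}(\mathcal{J},\mathcal{J},\mathcal{J})\}$; (2) $\mathfrak{b}(\mathcal{I}\oplus\mathcal{J},\mathcal{I}\oplus\mathcal{J},\mathrm{Fin})=\min\{\mathfrak{b}(\mathcal{I},\mathcal{I},\mathrm{Fin}),\mathfrak{b}(\mathcal{J},\mathcal{J},\mathrm{Fin})\}$; (3) $\mathfrak{b}(\mathcal{I}\oplus\mathcal{J},\mathrm{Fin},\mathrm{Fin})=\min\{\mathfrak{b}(\mathcal{I},\mathrm{Fin},\mathrm{Fin}),\mathfrak{b}(\mathcal{J},\mathrm{Fin},\mathrm{Fin})\}$; (4) $\mathfrak{b}_s(\mathrm{Fin},\mathcal{I}\oplus\mathcal{J},\mathcal{I}\oplus\mathcal{J})=\min\{\mathfrak{b}_s(\mathrm{Fin},\mathcal{I},\mathcal{I}),\mathfrak{b}_s(\mathrm{Fin},\mathcal{J},\mathcal{J})\}$.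
   Context: An ideal on a countable infinite set $X$ is a family $\mathcal{I}\subseteq\mathcal{P}(X)$ closed under finite unions and subsets, containing all finite subsets, with $X\notin\mathcal{I}$; $\mathrm{Fin}$ denotes the ideal of finite subsets of the relevant set. For ideals $\mathcal{I},\mathcal{J}$ on $\omega$, $\mathcal{I}\oplus\mathcal{J}$ is the ideal on $\omega\times\{0,1\}$ consisting of all $A$ with $\{x:(x,0)\in A\}\in\mathcal{I}$ and $\{y:(y,1)\in A\}\in\mathcal{J}$. For an ideal $\mathcal{K}$ on $X$, $\widehat{\mathcal{P}}_{\mathcal{K}}$ is the family of sequences $\langle A_n:n\in\omega\rangle$ of pairwise disjoint members of $\mathcal{K}$, and $\mathcal{P}_{\mathcal{K}}$ those with union $X$. For ideals $\mathcal{I},\mathcal{J},\mathcal{K}$ on $X$: $\mathfrak{b}(\mathcal{I},\mathcal{J},\mathcal{K})=\min\{|\mathcal{E}|:\mathcal{E}\subseteq\widehat{\mathcal{P}}_{\mathcal{K}},\ \forall\langle A_n\rangle\in\mathcal{P}_{\mathcal{J}}\ \exists\langle E_n\rangle\in\mathcal{E}\ \bigcup_n(A_n\cap\bigcup_{i\le n}E_i)\notin\mathcal{I}\}$ and $\mathfrak{b}_s(\mathcal{I},\mathcal{J},\mathcal{K})$ is the same with $A_{n+1}$ in place of $A_n$; $\min\emptyset=\mathfrak{c}^+$. *)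

(* Defs.v *)
From HB Require Import structures.
From mathcomp Require Import all_boot all_classical.

Set Implicit Arguments.
Unset Strict Implicit.
Unset Printing Implicit Defensive.

Local Open Scope classical_set_scope.
Local Open Scope card_scope.

(* A cardinal is an equipotence class of types, so that Leibniz equality of
   cardinals is equipotence.  Collections of types and of cardinals are written
   [_ -> Prop] rather than [set _]: [set] is universe monomorphic, and applying
   it to [Type] would exclude [set nat] from the types having a cardinality. *)
Definition cardinal :=
  {C : Type -> Prop |
    exists T : Type, C = (fun U : Type => [set: U] #= [set: T] : Prop)}.

Lemma cardinality_subproof (T : Type) (A : set T) :
  exists T0 : Type, (fun U : Type => [set: U] #= A : Prop)
                  = (fun U : Type => [set: U] #= [set: T0] : Prop).
Proof.
by exists A; apply/funext => U; rewrite (card_eqr (card_setT A)).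
Qed.

Definition cardinality (T : Type) (A : set T) : cardinal :=
  exist _ _ (cardinality_subproof A).

Definition cardinal_le (k l : cardinal) : Prop :=
  exists T U : Type, [/\ sval k T, sval l U & [set: T] #<= [set: U]].

Definition cardinal_lt (k l : cardinal) : Prop := cardinal_le k l /\ k <> l.

Definition is_least (S : cardinal -> Prop) (k : cardinal) : Prop :=
  S k /\ forall l, S l -> cardinal_le k l.

(* The minimum of [S], with the convention that the minimum of the empty
   collection is [d]; see [cardinal_minP] and [cardinal_min0]. *)
Definition cardinal_min (d : cardinal) (S : cardinal -> Prop) : cardinal :=
  if pselect (exists k, is_least S k) is left h then sval (cid h) else d.

Definition cardinal_min2 (k l : cardinal) : cardinal :=
  if `[< cardinal_le k l >] then k else l.

Definition continuum : cardinal := cardinality [set: set nat].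

(* The default value is irrelevant: by Cantor's theorem some cardinal is larger
   than the continuum. *)
Definition continuum_succ : cardinal :=
  cardinal_min continuum (cardinal_lt continuum).

Lemma cardinality_eqP (T U : Type) (A : set T) (B : set U) :
  cardinality A = cardinality B <-> A #= B.
Proof.
split=> [e|AB].
  have : sval (cardinality A) A by exact: card_setT.
  by rewrite e /= (card_eql (card_setT A)).
apply: eq_exist; apply/funext => V; by rewrite (card_eqr AB).
Qed.

Lemma cardinalityE (k : cardinal) : exists T : Type, k = cardinality [set: T].
Proof. by case: k => C [T CE]; exists T; apply: eq_exist. Qed.

Lemma cardinality_leP (T U : Type) (A : set T) (B : set U) :
  cardinal_le (cardinality A) (cardinality B) <-> A #<= B.
Proof.
split=> [[V [W [/= VA WB]]]|AB].
  by rewrite (card_le_eql VA) (card_le_eqr WB).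
exists A, B; split; [exact: card_setT|exact: card_setT|].
by rewrite (card_le_eql (card_setT A)) (card_le_eqr (card_setT B)).
Qed.

Lemma inj_type_card_le (T U : Type) (f : T -> U) :
  injective f -> [set: T] #<= [set: U].
Proof.
move=> finj; have /card_le_eql <- : f @` [set: T] #= [set: T].
  by apply: inj_card_eq => x y _ _; exact: finj.
exact: card_leT.
Qed.

Lemma card_le_subset_of (T U : Type) : [set: T] #<= [set: U] ->
  exists A : set U, A #= [set: T].
Proof.
move=> /card_leP[f]; exists (range (fun x => val (f x))).
apply: (card_eq_trans (inj_card_eq _)) (card_setT _) => x y _ _.
by move=> /val_inj; apply: inj; rewrite inE.
Qed.

Lemma least_type_of_family (J : Type) (F : J -> Type) : inhabited J ->
  exists i, forall j, [set: F i] #<= [set: F j].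
Proof.
move=> [j0].
pose P (W : set (forall i, F i)) :=
  forall f g, W f -> W g -> forall i, f i = g i -> f = g.
have [|W [PW maxW]] := @Zorn_bigcup _ P.
  move=> C CP Ctot f g [A CA Af] [B CB Bg].
  by have [AB|BA] := Ctot _ _ CA CB; [apply: (CP _ CB) => //; exact: AB|
                                      apply: (CP _ CA) => //; exact: BA].
have [i Wi] : exists i, forall x : F i, exists2 f, W f & f i = x.
  apply: contrapT => /forallNP H.
  have {}H i : exists x : F i, forall f, W f -> f i <> x.
    move: (H i) => /existsNP[x Hx]; exists x => f Wf fx.
    by apply: Hx; exists f.
  pose h i := sval (cid (H i)).
  have hW f i : W f -> f i <> h i by move=> Wf; exact: (svalP (cid (H i)) f Wf).
  apply: (maxW (W `|` [set h])).
    split=> [f Wf|/(_ h (or_intror erefl)) Wh]; first by left.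
    exact: (hW h j0 Wh).
  move=> f g [Wf|->] [Wg|->] i // e; first exact: PW e.
  - by case: (hW f i Wf).
  - by case: (hW g i Wg).
exists i => j.
pose s (x : F i) := s2val (cid2 (Wi x)).
have sW x : W (s x) by exact: s2valP (cid2 (Wi x)).
have sE x : s x i = x by exact: s2valP' (cid2 (Wi x)).
apply: (@inj_type_card_le _ _ (fun x : F i => s x j)) => x y e.
by rewrite -(sE x) -(sE y) (PW _ _ (sW x) (sW y) _ e).
Qed.

Lemma cardinal_le_total (k l : cardinal) : cardinal_le k l \/ cardinal_le l k.
Proof.
have [T ->] := cardinalityE k; have [U ->] := cardinalityE l.
have [[] /= le] := @least_type_of_family bool (fun b => if b then T else U)
  (inhabits true).
- by left; apply/cardinality_leP/(le false).
- by right; apply/cardinality_leP/(le true).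
Qed.

Lemma exists_least (S : cardinal -> Prop) :
  (exists k, S k) -> exists k, is_least S k.
Proof.
move=> [k Sk]; have [T kE] := cardinalityE k.
pose J := {A : set T | S (cardinality A)}.
have ST : S (cardinality [set: T]) by rewrite -kE.
have [A minA] := @least_type_of_family J (fun A => set_type (sval A))
  (inhabits (exist _ setT ST)).
have {}minA (B : set T) : S (cardinality B) -> sval A #<= B.
  move=> SB; have := minA (exist _ B SB).
  by rewrite /= (card_le_eql (card_setT _)) (card_le_eqr (card_setT _)).
exists (cardinality (sval A)); split; first exact: svalP A.
move=> l; have [U ->] := cardinalityE l => Sl.
apply/cardinality_leP.
have [|/cardinality_leP/card_le_subset_of[B BU]] :=
  cardinal_le_total (cardinality [set: T]) (cardinality [set: U]).
  by move=> /cardinality_leP; exact/card_le_trans/minA.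
rewrite -(card_le_eqr BU); apply: minA.
by have /cardinality_eqP -> := BU.
Qed.

Lemma cardinal_minP (d : cardinal) (S : cardinal -> Prop) :
  (exists k, S k) -> is_least S (cardinal_min d S).
Proof.
move=> /exists_least h; rewrite /cardinal_min.
by case: pselect => [h'|//]; case: (cid h').
Qed.

Lemma cardinal_min0 (d : cardinal) (S : cardinal -> Prop) :
  ~ (exists k, S k) -> cardinal_min d S = d.
Proof.
move=> S0; rewrite /cardinal_min; case: pselect => // h.
by case: S0; case: h => k [Sk _]; exists k.
Qed.

Lemma continuum_succP : is_least (cardinal_lt continuum) continuum_succ.
Proof.
apply: cardinal_minP; exists (cardinality [set: set (set nat)]); split.
  apply/cardinality_leP/(@inj_type_card_le _ _ set1) => A B.
  by move=> /seteqP[/(_ A erefl)].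
move=> /cardinality_eqP; rewrite card_eq_sym card_eq_le => /andP[+ _].
move=> /pcard_injP[g ginj].
pose D : set (set nat) := [set a | exists2 S, a = g S & ~ S a].
have nD : ~ D (g D).
  move=> [S gS nS]; have SD : D = S by apply: ginj gS; rewrite inE.
  by apply: (nS); rewrite -SD; exists S.
by apply: (nD); exists D.
Qed.

Definition is_ideal (X : Type) (I : set (set X)) : Prop :=
  [/\ forall A B, I A -> I B -> I (A `|` B),
      forall A B, A `<=` B -> I B -> I A,
      forall A, finite_set A -> I A
    & ~ I setT].

Definition Fin {X : Type} : set (set X) := [set A | finite_set A].

(* On [nat * bool], with [false] and [true] in the roles of 0 and 1. *)
Definition ideal_sum (I J : set (set nat)) : set (set (nat * bool)) :=
  [set A | I [set x | A (x, false)] /\ J [set y | A (y, true)]].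

Lemma ideal_sum_ideal (I J : set (set nat)) :
  is_ideal I -> is_ideal J -> is_ideal (ideal_sum I J).
Proof.
move=> [IU IS IF IT] [JU JS JF JT]; split.
- by move=> A B [IA JA] [IB JB]; split; [exact: IU IA IB|exact: JU JA JB].
- move=> A B AB [IB JB]; split; [apply: IS IB|apply: JS JB] => x /=; exact: AB.
- move=> A Afin; split; [apply: IF|apply: JF].
  + by apply: (finite_preimage (f := pair^~ false)) Afin => x y _ _ [].
  + by apply: (finite_preimage (f := pair^~ true)) Afin => x y _ _ [].
- by move=> [/IT].
Qed.

Definition Phat (X : Type) (K : set (set X)) : set (nat -> set X) :=
  [set A | (forall n, K (A n)) /\ trivIset setT A].

Definition Ppart (X : Type) (K : set (set X)) : set (nat -> set X) :=
  [set A | Phat K A /\ \bigcup_n A n = setT].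

Definition bnum (X : Type) (I J K : set (set X)) : cardinal :=
  cardinal_min continuum_succ (fun k =>
    exists F : set (nat -> set X),
    [/\ F `<=` Phat K,
        forall A, Ppart J A -> exists2 E, F E &
          ~ I (\bigcup_n (A n `&` \bigcup_(i in [set i | (i <= n)%N]) E i))
      & k = cardinality F]).

Definition bsnum (X : Type) (I J K : set (set X)) : cardinal :=
  cardinal_min continuum_succ (fun k =>
    exists F : set (nat -> set X),
    [/\ F `<=` Phat K,
        forall A, Ppart J A -> exists2 E, F E &
          ~ I (\bigcup_n (A n.+1 `&` \bigcup_(i in [set i | (i <= n)%N]) E i))
      & k = cardinality F]).

(* Main.v *)
(* Slicing a sequence of subsets of [nat * bool] along the two copies of [nat]
   commutes with all the operations in the definition of the invariants, and
   [Fin] is itself the sum [Fin + Fin]; so all four equalities are instances of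
   one statement about a triple of sums.  A witness on one copy, extended by the
   empty set on the other, is a witness for the sum.  Conversely, if neither
   family of slices of [F] were a witness, the two partitions refuting this would
   glue to a partition refuting [F].  Every witness has size at most the
   continuum, so the default value [continuum_succ] is absorbed by the minimum. *)
Require Import Defs.
From mathcomp Require Import all_boot all_classical.

Set Implicit Arguments.
Unset Strict Implicit.
Unset Printing Implicit Defensive.

Local Open Scope classical_set_scope.
Local Open Scope card_scope.

(** * Order and minima of cardinals *)

Lemma cardinal_le_refl (k : cardinal) : cardinal_le k k.
Proof. by have [T ->] := cardinalityE k; apply/cardinality_leP. Qed.

Lemma cardinal_le_trans (k l m : cardinal) :
  cardinal_le k l -> cardinal_le l m -> cardinal_le k m.
Proof.
have [T ->] := cardinalityE k; have [U ->] := cardinalityE l.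
have [V ->] := cardinalityE m => /cardinality_leP TU /cardinality_leP UV.
exact/cardinality_leP/(card_le_trans TU UV).
Qed.

Lemma cardinal_le_anti (k l : cardinal) :
  cardinal_le k l -> cardinal_le l k -> k = l.
Proof.
have [T ->] := cardinalityE k; have [U ->] := cardinalityE l.
move=> /cardinality_leP TU /cardinality_leP UT.
by apply/cardinality_eqP; rewrite card_eq_le TU UT.
Qed.

Lemma is_least_unique (S : cardinal -> Prop) (k l : cardinal) :
  is_least S k -> is_least S l -> k = l.
Proof.
by move=> [Sk kmin] [Sl lmin]; apply: cardinal_le_anti; [exact: kmin|exact: lmin].
Qed.

Lemma cardinal_min2_lel (k l : cardinal) : cardinal_le (cardinal_min2 k l) k.
Proof.
rewrite /cardinal_min2; case: asboolP => [_|]; first exact: cardinal_le_refl.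
by case: (cardinal_le_total k l).
Qed.

Lemma cardinal_min2_ler (k l : cardinal) : cardinal_le (cardinal_min2 k l) l.
Proof.
by rewrite /cardinal_min2; case: asboolP => // _; exact: cardinal_le_refl.
Qed.

(** When [d] bounds [S], adding it as one more candidate treats empty and nonempty [S] uniformly. *)
Lemma cardinal_min_least (d : cardinal) (S : cardinal -> Prop) :
  (forall k, S k -> cardinal_le k d) ->
  is_least (fun k => S k \/ k = d) (cardinal_min d S).
Proof.
move=> Sd; have [Sne|S0] := pselect (exists k, S k).
  have [Sm lem] := cardinal_minP d Sne; split; first by left.
  by move=> l [/lem//|->]; exact: Sd.
rewrite cardinal_min0 //; split; first by right.
by move=> l [Sl|->]; [case: S0; exists l|exact: cardinal_le_refl].
Qed.

(** Both sides are least in [S] enlarged by [d]: each [T b] lies inside [S], and together the two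
    reach below every member of [S]. *)
Lemma cardinal_min_or (d : cardinal) (S : cardinal -> Prop)
    (T : bool -> cardinal -> Prop) :
  (forall k, S k -> cardinal_le k d) ->
  (forall b k, T b k -> S k) ->
  (forall k, S k -> exists b l, T b l /\ cardinal_le l k) ->
  cardinal_min d S
    = cardinal_min2 (cardinal_min d (T false)) (cardinal_min d (T true)).
Proof.
move=> Sd TS ST.
have Tmin b := cardinal_min_least (fun k Tk => Sd k (TS b k Tk)).
apply: is_least_unique (cardinal_min_least Sd) _.
have min2_le b : cardinal_le
    (cardinal_min2 (cardinal_min d (T false)) (cardinal_min d (T true)))
    (cardinal_min d (T b)).
  by case: b; [exact: cardinal_min2_ler|exact: cardinal_min2_lel].
split.
  rewrite /cardinal_min2; case: ifP => _.
  - by have [[/TS|]] := Tmin false; [left|right].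
  - by have [[/TS|]] := Tmin true; [left|right].
(* For the candidate [d] either index would do, since [d] competes in both minima on the right. *)
move=> k [/ST[b [l [Tl lk]]]|->]; last first.
  apply: cardinal_le_trans (min2_le true) _.
  by have [_] := Tmin true; apply; right.
apply: cardinal_le_trans (min2_le b) _; apply: cardinal_le_trans lk.
by have [_] := Tmin b; apply; left.
Qed.

(** A sequence of subsets of [X] is determined by its graph in [nat * X], which [pickle] codes as a
    subset of [nat]. *)
Lemma card_seq_sets_le_continuum (X : countType) (F : set (nat -> set X)) :
  cardinal_le (cardinality F) continuum.
Proof.
apply/cardinality_leP; apply: card_le_trans (card_leT F) _.
pose g (E : nat -> set X) : set nat :=
  [set m | exists n x, m = pickle (n, x) /\ E n x].
apply: (@inj_type_card_le _ _ g) => D E gDE.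
have sub (D' E' : nat -> set X) n : g D' = g E' -> D' n `<=` E' n.
  move=> e x Dx; have : g D' (pickle (n, x)) by exists n, x.
  by rewrite e => -[n' [x' [/(pcan_inj pickleK)[-> ->]]]].
by apply/funext => n; apply/seteqP; split; apply: sub.
Qed.

(* [s] is the identity for [bnum] and the successor for [bsnum]. *)
Definition diagonal_union (X : Type) (s : nat -> nat) (A E : nat -> set X) :
    set X :=
  \bigcup_n (A (s n) `&` \bigcup_(i in [set i | (i <= n)%N]) E i).

Definition unbounded (X : Type) (s : nat -> nat) (I J K : set (set X))
    (F : set (nat -> set X)) : Prop :=
  F `<=` Phat K /\
  forall A, Ppart J A -> exists2 E, F E & ~ I (diagonal_union s A E).

Definition unbounded_number (X : Type) (s : nat -> nat) (I J K : set (set X)) :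
    cardinal :=
  cardinal_min continuum_succ (fun k =>
    exists F, unbounded s I J K F /\ k = cardinality F).

Lemma bnumE (X : Type) (I J K : set (set X)) :
  bnum I J K = unbounded_number id I J K.
Proof.
congr cardinal_min; apply/funext => k; apply/propext.
by split=> [[F [FK unbF ->]]|[F [[FK unbF] ->]]]; exists F.
Qed.

Lemma bsnumE (X : Type) (I J K : set (set X)) :
  bsnum I J K = unbounded_number succn I J K.
Proof.
congr cardinal_min; apply/funext => k; apply/propext.
by split=> [[F [FK unbF ->]]|[F [[FK unbF] ->]]]; exists F.
Qed.

(** * Slicing along the two copies of [nat] *)

Definition slice (b : bool) (E : nat -> set (nat * bool)) (n : nat) : set nat :=
  [set x | E n (x, b)].

Definition glue (E : bool -> nat -> set nat) (n : nat) : set (nat * bool) :=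
  [set p | E p.2 n p.1].

Definition extend (b : bool) (E : nat -> set nat) : nat -> set (nat * bool) :=
  glue (fun c n => if c == b then E n else set0).

Lemma slice_glue (b : bool) (E : bool -> nat -> set nat) :
  slice b (glue E) = E b.
Proof. by []. Qed.

Lemma slice_extend (b : bool) (E : nat -> set nat) : slice b (extend b E) = E.
Proof. by rewrite /extend slice_glue eqxx. Qed.

Lemma ideal_sumP (I : bool -> set (set nat)) (A : set (nat * bool)) :
  ideal_sum (I false) (I true) A <-> forall b, I b [set x | A (x, b)].
Proof. by split=> [[IA JA] []|IA] //; split; exact: IA. Qed.

Lemma ideal_sum_Fin : ideal_sum Fin Fin = Fin.
Proof.
apply/seteqP; split=> A.
  move=> [/(finite_image (pair^~ false)) Af /(finite_image (pair^~ true)) At].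
  (* [A] is covered by the embedded copies of its two finite slices. *)
  apply: (@sub_finite_set _ _ _ _ (_ : finite_set (_ `|` _)));
    last by rewrite finite_setU; split; [exact: Af|exact: At].
  by move=> [x []] Ax; [right|left]; exists x.
move=> Afin; split; apply: finite_preimage Afin => x y _ _ /=; by case.
Qed.

Lemma slice_diagonal_union (s : nat -> nat) (A E : nat -> set (nat * bool))
    (b : bool) :
  [set x | diagonal_union s A E (x, b)]
    = diagonal_union s (slice b A) (slice b E).
Proof. by []. Qed.

(** Disjointness can be tested copy by copy because a common point of two terms lies in a single
    copy. *)
Lemma Phat_slice (K : bool -> set (set nat)) (E : nat -> set (nat * bool)) :
  Phat (ideal_sum (K false) (K true)) E <-> forall b, Phat (K b) (slice b E).
Proof.
split=> [[KE disj] b|KE].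
  split=> [n|]; first exact: (ideal_sumP K _).1 (KE n) b.
  by move=> i j _ _ [x [Ei Ej]]; apply: disj => //; exists (x, b).
split=> [n|i j _ _ [[x b] [Ei Ej]]].
  by apply/(ideal_sumP K) => b; have [/(_ n)] := KE b.
by have [_ /(_ i j)] := KE b; apply=> //; exists x.
Qed.

Lemma Ppart_slice (J : bool -> set (set nat)) (A : nat -> set (nat * bool)) :
  Ppart (ideal_sum (J false) (J true)) A <-> forall b, Ppart (J b) (slice b A).
Proof.
split=> [[/Phat_slice JA cov] b|JA].
  split; first exact: JA.
  apply/seteqP; split=> // x _.
  have [n _ An] : (\bigcup_n A n) (x, b) by rewrite cov.
  by exists n.
split; first by apply/Phat_slice => b; have [] := JA b.
apply/seteqP; split=> // -[x b] _.
have [_ cov] := JA b.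
have [n _ An] : (\bigcup_n slice b A n) x by rewrite cov.
by exists n.
Qed.

(** * The invariants of a sum of ideals *)

Section IdealSums.
Variables (s : nat -> nat) (I J K : bool -> set (set nat)).

Let sum (L : bool -> set (set nat)) := ideal_sum (L false) (L true).

Lemma unbounded_extend (b : bool) (F : set (nat -> set nat)) :
  (forall c, K c set0) -> unbounded s (I b) (J b) (K b) F ->
  unbounded s (sum I) (sum J) (sum K) (extend b @` F).
Proof.
move=> K0 [FK unbF]; split.
  move=> _ [E /FK[KE disj] <-]; apply/Phat_slice => c.
  (* Off the copy [b] the slice is constantly empty: its terms are in [K c] by [K0], and it is
     trivially disjoint. *)
  rewrite /extend slice_glue; case: eqP => [->|_]; first by [].
  by split=> // i j _ _ [x []].
move=> A /Ppart_slice/(_ b)/unbF[E FE nIE]; exists (extend b E).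
  by exists E.
by move=> /ideal_sumP/(_ b); rewrite slice_diagonal_union slice_extend.
Qed.

Lemma unbounded_slice (F : set (nat -> set (nat * bool))) :
  unbounded s (sum I) (sum J) (sum K) F ->
  exists b, unbounded s (I b) (J b) (K b) (slice b @` F).
Proof.
move=> [FK unbF]; apply: contrapT => /forallNP nunb.
(* The slices of [F] always lie in [Phat (K b)], so failure on copy [b] must come from one partition
   that bounds all of them. *)
have bounded b : exists A, Ppart (J b) A /\
    forall E, F E -> I b (diagonal_union s A (slice b E)).
  apply: contrapT => /forallNP H; apply: (nunb b); split.
    by move=> _ [E /FK/Phat_slice KE <-]; exact: KE.
  move=> A JA; apply: contrapT => nE; apply: (H A); split=> // E FE.
  by apply: contrapT => nI; apply: nE; exists (slice b E) => //; exists E.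
have [A HA] := choice bounded.
have [|E FE] := unbF (glue A).
  by apply/Ppart_slice => b; rewrite slice_glue; case: (HA b).
by apply; apply/ideal_sumP => b; case: (HA b) => _; exact.
Qed.

Lemma unbounded_number_sum : (forall c, K c set0) ->
  unbounded_number s (sum I) (sum J) (sum K)
    = cardinal_min2 (unbounded_number s (I false) (J false) (K false))
                    (unbounded_number s (I true) (J true) (K true)).
Proof.
move=> K0; apply: (@cardinal_min_or _ _ (fun b k =>
  exists F, unbounded s (I b) (J b) (K b) F /\ k = cardinality F)).
(* This makes [continuum_succ] an upper bound for the candidates, as the default value must be. *)
- move=> _ [F [_ ->]].
  apply: cardinal_le_trans (card_seq_sets_le_continuum F) _.
  by have [[]] := continuum_succP.
- move=> b _ [F [unbF ->]]; exists (extend b @` F).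
  split; first exact: unbounded_extend.
  (* Extension preserves the size of [F], being injective with left inverse [slice b]. *)
  apply/cardinality_eqP; rewrite card_eq_sym; apply: inj_card_eq => D E _ _.
  by move=> /(congr1 (slice b)); rewrite !slice_extend.
(* Slicing may identify members of [F], so the size can drop; an inequality is all that is required
   here. *)
- move=> _ [F [/unbounded_slice[b unbF] ->]].
  exists b, (cardinality (slice b @` F)); split; first by exists (slice b @` F).
  exact/cardinality_leP/card_image_le.
Qed.

End IdealSums.

Theorem theorem5p1 (I J : set (set nat)) (hI : is_ideal I) (hJ : is_ideal J) :
  [/\ bnum (ideal_sum I J) (ideal_sum I J) (ideal_sum I J)
        = cardinal_min2 (bnum I I I) (bnum J J J),
      bnum (ideal_sum I J) (ideal_sum I J) Fin
        = cardinal_min2 (bnum I I Fin) (bnum J J Fin),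
      bnum (ideal_sum I J) Fin Fin
        = cardinal_min2 (bnum I Fin Fin) (bnum J Fin Fin)
    & bsnum Fin (ideal_sum I J) (ideal_sum I J)
        = cardinal_min2 (bsnum Fin I I) (bsnum Fin J J)].
Proof.
pose IJ b := if b then J else I.
pose FF (_ : bool) : set (set nat) := Fin.
have IJ0 b : IJ b set0.
  by case: hI hJ => _ _ IF _ [_ _ JF _]; case: b; [exact: JF|exact: IF].
have FF0 b : FF b set0 by exact: finite_set0.
(* Only [Fin] on [nat * bool] is turned into a sum; its summands on [nat] are the values of the
   constant family [FF]. *)
rewrite !bnumE !bsnumE -ideal_sum_Fin; split.
- exact: (unbounded_number_sum id IJ IJ IJ0).
- exact: (unbounded_number_sum id IJ IJ FF0).
- exact: (unbounded_number_sum id IJ FF FF0).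
- exact: (unbounded_number_sum succn FF IJ IJ0).
Qed.
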